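(* There exist finite positive constants $c_1$ and $c_2$ such that the following holds. Let $P_{XY}$ (the data distribution) and $Q_{XY}$ (the distribution implied by the generative model) be probability distributions on $\mathcal{X}\times\mathcal{Y}$, where $\mathcal{X}=\mathbb{R}^d$ and $\mathcal{Y}=\{1,\ldots,K\}$. Let $Q'_{Y|X}$ be a conditional distribution of ordinary labels given features (the one induced by a classifier $C$). Let $M$ be the $K\times K$ transition matrix, $M_{ij}=P(\bar Y=j\mid Y=i)$, relating ordinary labels $Y$ to complementary labels $\bar Y$, and let $P_{\bar Y|X}$ and $Q'_{\bar Y|X}$ be the conditional distributions of complementary labels given features obtained from $P_{Y|X}$ and $Q'_{Y|X}$ through $M$, i.e. $P_{\bar Y|X}=M^{\top}P_{Y|X}$ and $Q'_{\bar Y|X}=M^{\top}Q'_{Y|X}$. If $M$ is full rank, then $$d_{TV}(P_{XY},Q_{XY})\le 2c_1\sqrt{d_{JS}(P_X,Q_X)}+c_2\,\|M^{-1}\|_\infty\sqrt{d_{KL}(P_{\bar Y|X},Q'_{\bar Y|X})}+c_2\sqrt{d_{KL}(Q_{Y|X},Q'_{Y|X})}.$$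
   Context: Setting. $X\in\mathbb{R}^d$ is the feature variable, $Y\in\{1,\dots,K\}$ the ordinary label, and $\bar Y\in\{1,\dots,K\}\setminus\{Y\}$ the complementary label (a class the instance does not belong to). The complementary label depends on $X$ only through $Y$. Thus $M$ is a row-stochastic matrix with $M_{ij}=P(\bar Y=j\mid Y=i)$ and $M_{ii}=0$, and $$P(\bar Y=j\mid X)=\sum_{i\ne j}M_{ij}\,P(Y=i\mid X).$$ Conditional label distributions given $X=x$ are identified with column vectors in $\mathbb{R}^K$, so this reads $P_{\bar Y|X}=M^\top P_{Y|X}$. Similarly, $Q'_{\bar Y|X}=M^\top Q'_{Y|X}$. $P_X,Q_X$ denote the $X$-marginals of $P_{XY},Q_{XY}$, and $P_{Y|X},Q_{Y|X}$ the corresponding conditional distributions. $Q'_{Y|X}$ is given by a measurable function $C$ from $\mathbb{R}^d$ to the probability simplex in $\mathbb{R}^K$ (class-probability outputs), with $Q'(Y=i\mid X=x)=C(x)_i$. Divergences. For probability measures $\mu,\nu$: - $d_{TV}(\mu,\nu)=\sup_A|\mu(A)-\nu(A)|$ (equivalently $\frac12\int|p-q|$ for densities $p,q$). - $d_{KL}(\mu,\nu)=\int\log\frac{d\mu}{d\nu}\,d\mu$ (equal to $+\infty$ if $\mu$ is not absolutely continuous with respect to $\nu$). - $d_{JS}(\mu,\nu)=\frac12 d_{KL}(\mu,\frac{\mu+\nu}{2})+\frac12 d_{KL}(\nu,\frac{\mu+\nu}{2})$. Logarithms are natural. The KL divergence between conditional distributions is averaged over the feature marginal belonging to its first argument: $$d_{KL}(P_{\bar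 Y|X},Q'_{\bar Y|X})=\mathbb{E}_{x\sim P_X}\, d_{KL}\big(P_{\bar Y|X=x},Q'_{\bar Y|X=x}\big),\qquad d_{KL}(Q_{Y|X},Q'_{Y|X})=\mathbb{E}_{x\sim Q_X}\, d_{KL}\big(Q_{Y|X=x},Q'_{Y|X=x}\big).$$ $\|A\|_\infty=\max_i\sum_j|A_{ij}|$ is the maximum absolute row sum norm of a matrix. *)

(* Defs.v *)
From HB Require Import structures.
From mathcomp Require Import all_boot all_order all_algebra.
From mathcomp Require Import all_classical all_reals all_analysis.

Set Implicit Arguments.
Unset Strict Implicit.
Unset Printing Implicit Defensive.

Import Order.TTheory GRing.Theory Num.Theory.

Local Open Scope classical_set_scope.
Local Open Scope ring_scope.

(* Measurable types are pointed in the library, hence labels are indexed by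
   'I_K.+1: there are K.+1 classes, numbered from 0. *)
HB.instance Definition _ (n : nat) := isPointed.Build 'I_n.+1 ord0.
HB.instance Definition _ (n : nat) := @isMeasurable.Build
  default_measure_display 'I_n.+1 discrete_measurable discrete_measurable0
  discrete_measurableC discrete_measurableU.

HB.instance Definition _ d1 d2 (T1 : measurableType d1)
    (T2 : measurableType d2) :=
  isMeasurableFun.Build _ _ (T1 * T2)%type T1 fst measurable_fst.

Section divergences.
Context d (T : measurableType d) (R : realType).
Implicit Types mu nu : probability T R.
Local Open Scope ereal_scope.

Definition d_TV mu nu : \bar R :=
  ereal_sup [set `|mu A - nu A| | A in measurable].

(* lne is -oo on nonpositive arguments, but the density of mu with respect to
   nu is positive mu-almost everywhere. *)
Definition d_KL mu nu : \bar R :=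
  if `[< mu `<< nu >] then
    \int[mu]_x lne (Radon_Nikodym (charge_of_finite_measure mu) nu x)
  else +oo.

Definition midpoint mu nu : set T -> \bar R :=
  measure_add (mscale (2^-1 : R)%:nng%R mu) (mscale (2^-1 : R)%:nng%R nu).

HB.instance Definition _ mu nu := Measure.on (midpoint mu nu).

Lemma midpoint_setT mu nu : midpoint mu nu setT = 1.
Proof.
rewrite /midpoint measure_addE /= /mscale/= !probability_setT !mule1 -EFinD.
by rewrite -[in LHS]div1r -splitr.
Qed.

HB.instance Definition _ mu nu :=
  Measure_isProbability.Build _ _ _ (midpoint mu nu) (midpoint_setT mu nu).

Definition d_JS mu nu : \bar R :=
  (2^-1)%:E * d_KL mu (midpoint mu nu) + (2^-1)%:E * d_KL nu (midpoint mu nu).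

End divergences.

Section labels.
Context (R : realType) (K : nat).

Record simplex := Simplex {
  simplex_vec :> 'cV[R]_K.+1;
  simplex_ge0 : forall i, 0 <= simplex_vec i 0;
  simplex_sum1 : \sum_i simplex_vec i 0 = 1 }.

Definition label_dist (p : simplex) : set 'I_K.+1 -> \bar R :=
  fun A => (\sum_(i < K.+1) (p i 0)%:E * \d_i A)%E.

Section label_dist_probability.
Variable p : simplex.
Local Open Scope ereal_scope.

Let label_dist0 : label_dist p set0 = 0.
Proof. by rewrite /label_dist big1// => i _; rewrite measure0 mule0. Qed.

Let label_dist_ge0 A : 0 <= label_dist p A.
Proof.
by apply: sume_ge0 => i _; rewrite mule_ge0// lee_fin simplex_ge0.
Qed.

Let label_dist_sigma_additive : semi_sigma_additive (label_dist p).
Proof.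
move=> F mF tF mUF.
have -> : (fun n => \sum_(0 <= k < n) label_dist p (F k)) =
    fun n => \sum_(i < K.+1) (p i 0)%:E * \sum_(0 <= k < n) \d_i (F k).
  apply/funext => n; rewrite exchange_big/=; apply: eq_bigr => i _.
  by rewrite ge0_sume_distrr.
apply: cvg_nnesum => [i _|i _].
  by apply: nearW => n; rewrite mule_ge0 ?lee_fin ?simplex_ge0// sume_ge0.
by apply: cvgeZl => //; exact: (@measure_semi_sigma_additive _ _ _ \d_i).
Qed.

HB.instance Definition _ := isMeasure.Build _ _ _ (label_dist p)
  label_dist0 label_dist_ge0 label_dist_sigma_additive.

Let label_dist_setT : label_dist p setT = 1.
Proof.
rewrite /label_dist (eq_bigr (fun i => (p i 0)%:E)); last first.
  by move=> i _; rewrite diracT mule1.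
by rewrite sumEFin simplex_sum1.
Qed.

HB.instance Definition _ :=
  Measure_isProbability.Build _ _ _ (label_dist p) label_dist_setT.

End label_dist_probability.

(* M i j is the probability of the complementary label j given the label i. *)
Record transition_matrix := TransitionMatrix {
  transition_mx :> 'M[R]_K.+1;
  transition_ge0 : forall i j, 0 <= transition_mx i j;
  transition_row1 : forall i, \sum_j transition_mx i j = 1;
  transition_diag0 : forall i, transition_mx i i = 0 }.

Section complementary.
Variables (M : transition_matrix) (p : simplex).

Let complementary_ge0 i : 0 <= ((M : 'M[R]_K.+1)^T *m p) i 0.
Proof.
rewrite mxE; apply: sumr_ge0 => j _.
by rewrite mxE mulr_ge0 ?transition_ge0 ?simplex_ge0.
Qed.

Let complementary_sum1 : \sum_i ((M : 'M[R]_K.+1)^T *m p) i 0 = 1.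
Proof.
under eq_bigr do rewrite mxE.
rewrite exchange_big/= -[RHS](simplex_sum1 p); apply: eq_bigr => j _.
under eq_bigr do rewrite mxE.
by rewrite -mulr_suml transition_row1 mul1r.
Qed.

Definition complementary : simplex :=
  Simplex complementary_ge0 complementary_sum1.

End complementary.

Definition norm_infty (A : 'M[R]_K.+1) : R :=
  \big[Num.max/0]_(i < K.+1) \sum_(j < K.+1) `|A i j|.

End labels.

Section conditional.
Context d (X : measurableType d) (R : realType) (K : nat).
Local Open Scope ereal_scope.

Definition marginal (P : probability (X * 'I_K.+1)%type R) : probability X R :=
  distribution P (fst : {mfun (X * 'I_K.+1)%type >-> X}).

Definition measurable_simplex (p : X -> simplex R K) : Prop :=
  forall i, measurable_fun setT (fun x => (p x i 0)%R).

(* p is a version of the conditional distribution of the label given the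
   feature under the joint distribution P. *)
Definition is_conditional (P : probability (X * 'I_K.+1)%type R)
    (p : X -> simplex R K) : Prop :=
  measurable_simplex p /\
  forall (A : set X) (i : 'I_K.+1), measurable A ->
    P (A `*` [set i]) = \int[marginal P]_(x in A) (p x i 0)%R%:E.

Definition d_KL_cond (mu : probability X R) (p q : X -> simplex R K) : \bar R :=
  \int[mu]_x d_KL (label_dist (p x)) (label_dist (q x)).

End conditional.

(* Main.v *)
(* Write P(A) and Q(A) as integrals of the conditional probabilities of the
   sections of A, and insert the classifier C. The difference splits into
   (P_X, Y|X) against (P_X, C), (P_X, C) against (Q_X, C), and (Q_X, C) against
   (Q_X, Y|X). The outer two terms are bounded by averaged l1 distances of label
   distributions, the first of which is transported to complementary labels by
   the inverse of M^T; the middle one is a difference of integrals of a function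
   bounded by 1. All are controlled by a Pinsker-type inequality with a free
   parameter, t * (difference) - 4 t^2 <= KL for all t > 0. Being linear in
   the difference, it can be integrated over the features, and t is chosen only
   afterwards, which replaces Jensen's inequality. *)
Require Import Defs.
From HB Require Import structures.
From mathcomp Require Import all_boot all_order all_algebra.
From mathcomp Require Import all_classical all_reals all_analysis.
From mathcomp Require Import measurable_realfun ring lra.

Set Implicit Arguments.
Unset Strict Implicit.
Unset Printing Implicit Defensive.

Import Order.TTheory GRing.Theory Num.Theory.

Local Open Scope classical_set_scope.
Local Open Scope ring_scope.

(** * Elementary inequalities: eliminating the parameter [t], bounding [expR] *)

(** The choice [t = sqrt J] balances both terms: [t * a <= J + c * t ^+ 2 = (1 + c) * t ^+ 2]. This
    is where a linear bound with a free parameter turns into a square-root bound. *)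
Lemma le_sqrte_of_quadratic (R : realType) (a c : R) (J : \bar R) : 0 <= c ->
  (forall t : R, 0 < t -> ((t * a - c * t ^+ 2)%:E <= J)%E) ->
  (a%:E <= (1 + c)%:E * sqrte J)%E.
Proof.
move=> c0; case: J => [r|_|/(_ 1 ltr01)]; last first.
- by rewrite leeNy_eq.
- by rewrite /= gt0_muley ?leey// lte_fin; lra.
move=> ar /=; rewrite -EFinM lee_fin.
have {}ar t : 0 < t -> t * a - c * t ^+ 2 <= r by move=> /ar; rewrite lee_fin.
have [r0|r0] := ltP 0 r.
  have s0 : 0 < Num.sqrt r by rewrite sqrtr_gt0.
  rewrite -(ler_pM2l s0); have := ar _ s0.
  by rewrite -{3}(sqr_sqrtr (ltW r0)); nra.
(* Here the square root is 0, so [a <= 0] is required; a small [t] gives [a <= c * t <= e] for every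
   [e > 0]. *)
rewrite ler0_sqrtr// mulr0; apply/ler_addgt0Pr => e e0; rewrite add0r.
have t0 : 0 < e / (1 + c) by rewrite divr_gt0//; lra.
have := ar _ t0; set t := e / (1 + c) in t0 *.
have -> : e = t * (1 + c) by rewrite /t divfK//; apply: lt0r_neq0; lra.
move=> H; rewrite -(ler_pM2l t0); nra.
Qed.

(** From [1 - u <= expR (- u)] one gets [expR u <= (1 - u)^-1], and [(1 - u) * (1 + u + 2 * u ^+ 2)
    = 1 + u ^+ 2 * (1 - 2 * u)] is at least 1. *)
Lemma expR_le_quadratic (R : realType) (u : R) : u <= 2^-1 ->
  expR u <= 1 + u + 2 * u ^+ 2.
Proof.
move=> u2; have u1 : 0 < 1 - u by lra.
have : expR u <= (1 - u)^-1.
  rewrite -[expR u]invrK lef_pV2 ?posrE ?invr_gt0 ?expR_gt0//.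
  by rewrite -expRN; exact: expR_ge1Dx.
move=> /le_trans; apply; rewrite -(ler_pM2l u1) mulfV ?lt0r_neq0//.
have : 0 <= u ^+ 2 * (1 - 2 * u) by rewrite mulr_ge0 ?sqr_ge0//; lra.
by nra.
Qed.

(** * Monotonicity of integrals and bounded functions under a probability *)

Section integral.
Context d (T : measurableType d) (R : realType).

(** Both integrals are suprema over the simple functions below the integrand, so a larger integrand
    admits more of them. It serves to bound the integral of [d_KL] over the features from below. *)
Lemma ge0_le_integralT (mu : {measure set T -> \bar R}) (f g : T -> \bar R) :
  (forall x, 0 <= f x)%E -> (forall x, f x <= g x)%E ->
  (\int[mu]_x f x <= \int[mu]_x g x)%E.
Proof.
move=> f0 fg; have g0 x : (0 <= g x)%E by exact: le_trans (fg x).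
rewrite !ge0_integralTE//; apply: le_ereal_sup => _ [h hf <-].
by exists h => // x; exact: le_trans (fg x).
Qed.

(** Positive parts grow and negative parts shrink. Integrability is not assumed, as a log-density
    may have infinite integral. *)
Lemma ae_le_integralT (mu : {measure set T -> \bar R}) (f g : T -> \bar R) :
  measurable_fun setT f -> measurable_fun setT g ->
  {ae mu, forall x, f x <= g x}%E ->
  (\int[mu]_x f x <= \int[mu]_x g x)%E.
Proof.
move=> mf mg fg; rewrite integralE [leRHS]integralE; apply: leeB.
  apply: ae_ge0_le_integral => //; [exact: measurable_funepos..|].
  apply: filterS fg => x fgx _; rewrite !funeposE.
  by rewrite ge_max !le_max lexx fgx orbT.
apply: ae_ge0_le_integral => //; [exact: measurable_funeneg..|].
apply: filterS fg => x fgx _; rewrite !funenegE.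
by rewrite ge_max !le_max lexx leeN2 fgx orbT.
Qed.

Lemma probability_bounded_integrable (mu : probability T R) (f : T -> R)
    (B : R) :
  measurable_fun setT f -> (forall x, `|f x| <= B) ->
  mu.-integrable setT (EFin \o f).
Proof.
move=> mf fB; apply: measurable_bounded_integrable => //.
  by rewrite /= probability_setT ltry.
exists B; split; first exact: num_real.
by move=> x Bx y _ /=; rewrite (le_trans (fB y))// ltW.
Qed.

Lemma Rintegral_cstT (mu : probability T R) (r : R) : \int[mu]_x r = r.
Proof. by rewrite Rintegral_cst//= probability_setT /= mulr1. Qed.

Lemma EFin_Rintegral (mu : probability T R) (f : T -> R) :
  mu.-integrable setT (EFin \o f) ->
  (\int[mu]_x f x)%:E = (\int[mu]_x (f x)%:E)%E.
Proof. by move=> fi; rewrite /Rintegral fineK//; exact: integrable_fin_num. Qed.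

Lemma RintegralN (mu : probability T R) (f : T -> R) :
  mu.-integrable setT (EFin \o f) ->
  \int[mu]_x (- f x) = - \int[mu]_x f x.
Proof.
move=> fi; rewrite -mulN1r -RintegralZl//.
by apply: eq_Rintegral => x _; rewrite mulN1r.
Qed.

End integral.

(** * Pinsker-type lower bounds for the KL and JS divergences *)

Section kullback_leibler.
Context d (T : measurableType d) (R : realType).
Implicit Types (mu nu : probability T R) (g h : T -> R).

Lemma measurable_lne_comp (f : T -> \bar R) : (forall x, f x \is a fin_num) ->
  measurable_fun setT f -> measurable_fun setT (fun x => lne (f x)).
Proof.
move=> ffin mf; pose r x := fine (f x).
have mr : measurable_fun setT r by exact: measurableT_comp.
rewrite (_ : (fun x => _) = fun x => if r x <= 0 then -oo%E else (ln (r x))%:E).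
  apply: measurable_fun_ifT; [exact: measurable_fun_ler|by []|].
  by apply/measurable_EFinP; exact: measurableT_comp.
by apply/funext => x; rewrite -(fineK (ffin x)).
Qed.

(* A weak form of the Donsker-Varadhan inequality: by [1 + u <= exp u] at
   [u = h - ln f], the density [f] of [mu] with respect to [nu] satisfies
   [1 + h - exp h / f <= ln f], which is integrated against [mu]. *)
Lemma d_KL_ge_Rintegral mu nu h (B : R) :
  measurable_fun setT h -> (forall x, `|h x| <= B) ->
  ((1 + \int[mu]_x h x - \int[nu]_x expR (h x))%:E <= d_KL mu nu)%E.
Proof.
move=> mh hB; rewrite /d_KL; case: asboolP => [munu|_]; last by rewrite leey.
set f := Radon_Nikodym _ _.
have ffin x : f x \is a fin_num by exact: Radon_Nikodym_fin_num.
have fi : nu.-integrable setT f by exact: Radon_Nikodym_integrable.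
have mf : measurable_fun setT f by exact: measurable_int fi.
pose r x := fine (f x).
have fr x : f x = (r x)%:E by rewrite fineK.
have mr : measurable_fun setT r by exact: measurableT_comp.
(* The [mu]-measure of [r <= 0] is the [nu]-integral of a nonpositive density over that set, hence
   0. *)
have r_gt0 : {ae mu, forall x, 0 < r x}.
  have mN : measurable [set x | r x <= 0].
    have := measurable_fun_ler mr (measurable_cst (0 : R)).
    by move=> /(_ measurableT [set true]); rewrite setTI; exact.
  exists [set x | r x <= 0]; split => //; last first.
    by move=> x /=; rewrite leNgt; exact: contra_notN.
  apply/eqP; rewrite eq_le measure_ge0 andbT.
  have -> : mu [set x | r x <= 0] =
      charge_of_finite_measure mu [set x | r x <= 0] by [].
  rewrite (@Radon_Nikodym_integral _ _ _ (charge_of_finite_measure mu) nu _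
    munu mN) -/f.
  rewrite -[leRHS](integral0 nu [set x | r x <= 0]); apply: le_integral => //.
  - exact: integrableS fi.
  - exact: integrable0.
  - by move=> x; rewrite inE /= fr lee_fin.
(* [G] is [exp h / f], with the value 0 where the density is not positive, so that [G * f <= exp h]
   holds everywhere. *)
pose G x := if 0 < r x then expR (h x - ln (r x)) else 0.
have mG : measurable_fun setT G.
  apply: measurable_fun_ifT => //; first exact: measurable_fun_ltr.
  apply: measurableT_comp => //; apply: measurable_funB => //.
  exact: measurableT_comp.
have G0 x : 0 <= G x by rewrite /G; case: ifP => // _; exact: expR_ge0.
have ehi : nu.-integrable setT (EFin \o (fun x => expR (h x))).
  apply: (@probability_bounded_integrable _ _ _ _ _ (expR B)).
    exact: measurableT_comp.
  by move=> x; rewrite ger0_norm ?expR_ge0// ler_expR (le_trans (ler_norm _)).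
have Gle : (\int[mu]_x (G x)%:E <= \int[nu]_x (expR (h x))%:E)%E.
  have mGE : measurable_fun setT (EFin \o G) by exact/measurable_EFinP.
  rewrite -(@Radon_Nikodym_SigmaFinite.change_of_variables _ _ _ mu nu munu)//.
  apply: (@le_trans _ _ (\int[nu]_x ((G x)%:E * f x))%E).
    (* The change of variables produces another version of the density, [nu]-almost everywhere equal
       to [f]. *)
    rewrite le_eqVlt; apply/orP; left; apply/eqP; apply: ae_eq_integral => //.
    - apply: emeasurable_funM => //.
      exact: measurable_int (Radon_Nikodym_SigmaFinite.f_integrable _).
    - exact: emeasurable_funM.
    - by apply: ae_eqe_mul2l; exact: ae_eq_Radon_Nikodym_SigmaFinite.
  apply: ae_le_integralT.
  - exact: emeasurable_funM.
  - exact: measurable_int ehi.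
  - apply: aeW => x; rewrite fr -EFinM lee_fin /G; case: ifPn => r0.
      by rewrite expRB lnK ?posrE// divfK// gt_eqF.
    by rewrite mul0r expR_ge0.
have Gi : mu.-integrable setT (EFin \o G).
  apply/integrableP; split; first exact/measurable_EFinP.
  under eq_integral do rewrite /= ger0_norm//.
  apply: le_lt_trans Gle _; exact: integrable_lty ehi.
have hi : mu.-integrable setT (EFin \o h).
  exact: probability_bounded_integrable mh hB.
have ci : mu.-integrable setT (EFin \o cst (1 : R)).
  exact: finite_measure_integrable_cst.
have chi : mu.-integrable setT (EFin \o (fun x => 1 + h x)).
  by have := integrableD measurableT ci hi.
apply: (@le_trans _ _ (\int[mu]_x ((1 + h x - G x)%:E))%E).
  rewrite -EFin_Rintegral; last by have := integrableB measurableT chi Gi.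
  rewrite lee_fin RintegralB// RintegralD// Rintegral_cstT lerD2l lerN2.
  by rewrite -lee_fin !EFin_Rintegral.
apply: ae_le_integralT.
- apply/measurable_EFinP; apply: measurable_funB => //.
  exact: measurable_funD.
- exact: measurable_lne_comp.
- apply: filterS r_gt0 => x rx; rewrite fr lne_EFin// lee_fin /G rx.
  have := expR_ge1Dx (h x - ln (r x)); lra.
Qed.

Lemma d_KL_ge0 mu nu : (0 <= d_KL mu nu)%E.
Proof.
have := @d_KL_ge_Rintegral mu nu (cst 0) 0 (measurable_cst _).
under [X in _ - X]eq_Rintegral do rewrite expR0.
by rewrite !Rintegral_cstT addr0 subrr; apply => x; rewrite normr0.
Qed.

(** Test the previous variational bound with [h = t * g]. For [t <= 1/2] the quadratic bound on
    [expR] costs only [2 * t ^+ 2]; the constant 4 makes the left side nonpositive for larger [t],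
    since the integrals differ by at most 2. *)
Lemma d_KL_ge_quadratic mu nu g (t : R) :
  measurable_fun setT g -> (forall x, `|g x| <= 1) -> 0 < t ->
  ((t * (\int[mu]_x g x - \int[nu]_x g x) - 4 * t ^+ 2)%:E <= d_KL mu nu)%E.
Proof.
move=> mg g1 t0.
have gi (P : probability T R) : P.-integrable setT (EFin \o g).
  exact: probability_bounded_integrable g1.
have gabs (P : probability T R) : `|\int[P]_x g x| <= 1.
  apply: le_trans (le_normr_Rintegral _ (gi P)) _ => //.
  rewrite -[leRHS](Rintegral_cstT P); apply: le_Rintegral => //.
  - by have := integrable_norm (gi P).
  - exact: finite_measure_integrable_cst.
have [t2|t2] := leP t 2^-1; last first.
  apply: le_trans (d_KL_ge0 mu nu); rewrite lee_fin.
  have := gabs mu; have := gabs nu.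
  by rewrite !ler_norml => /andP[a1 a2] /andP[b1 b2]; nra.
have mtg : measurable_fun setT (fun x => t * g x) by exact: measurable_funM.
have tgt x : `|t * g x| <= t by rewrite normrM (gtr0_norm t0) ger_pMr.
apply: le_trans (d_KL_ge_Rintegral mu nu mtg tgt).
have tgi (P : probability T R) :
    P.-integrable setT (EFin \o (fun x => t * g x)).
  exact: probability_bounded_integrable tgt.
have ci : nu.-integrable setT (EFin \o cst (1 + 2 * t ^+ 2)).
  exact: finite_measure_integrable_cst.
have : \int[nu]_x expR (t * g x) <= \int[nu]_x (1 + 2 * t ^+ 2 + t * g x).
  apply: le_Rintegral => //.
  - apply: (@probability_bounded_integrable _ _ _ _ _ (expR t)).
      exact: measurableT_comp.
    by move=> x; rewrite ger0_norm ?expR_ge0// ler_expR (le_trans (ler_norm _)).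
  - by have := integrableD measurableT ci (tgi nu).
  - move=> x _; have tgx : t * g x <= t by rewrite (le_trans (ler_norm _)).
    apply: le_trans (expR_le_quadratic (le_trans tgx t2)) _.
    have : (t * g x) ^+ 2 <= t ^+ 2.
      by rewrite -(real_normK (num_real _)) lerXn2r ?nnegrE ?normr_ge0// ltW.
    by lra.
rewrite RintegralD//; last exact: tgi.
have RZ (P : probability T R) : \int[P]_x (t * g x) = t * \int[P]_x g x.
  by rewrite RintegralZl//; exact: gi.
rewrite Rintegral_cstT !RZ lee_fin => H.
have : 0 <= t ^+ 2 by exact: sqr_ge0.
nra.
Qed.

(** Use [g] for [mu] against the midpoint and [- g] for [nu] against it: the two midpoint integrals
    cancel in the average. *)
Lemma d_JS_ge_quadratic mu nu g (t : R) :
  measurable_fun setT g -> (forall x, `|g x| <= 1) -> 0 < t ->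
  ((t * ((\int[mu]_x g x - \int[nu]_x g x) / 2) - 4 * t ^+ 2)%:E
    <= d_JS mu nu)%E.
Proof.
move=> mg g1 t0; rewrite /d_JS.
set m := midpoint mu nu.
have mgN : measurable_fun setT (fun x => - g x) by exact: measurableT_comp.
have gN1 x : `|- g x| <= 1 by rewrite normrN.
have RN (P : probability T R) : \int[P]_x (- g x) = - \int[P]_x g x.
  by apply: RintegralN; exact: probability_bounded_integrable g1.
have := d_KL_ge_quadratic mu m mg g1 t0.
have := d_KL_ge_quadratic nu m mgN gN1 t0; rewrite !RN.
have half0 : (0 <= (2^-1 : R)%:E)%E by rewrite lee_fin.
move=> /(lee_wpmul2l half0) H1 /(lee_wpmul2l half0) H2.
apply: le_trans (leeD H2 H1); rewrite -!EFinM -EFinD lee_fin; lra.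
Qed.

End kullback_leibler.

(** * Label distributions, their l1 distance and the transition matrix *)

Section simplex.
Context (R : realType) (K : nat).
Implicit Types (p q : simplex R K) (M : transition_matrix R K).

Lemma simplex_le1 p i : p i 0 <= 1.
Proof.
rewrite -(simplex_sum1 p) (bigD1 i)//= lerDl; apply: sumr_ge0 => j _.
exact: simplex_ge0.
Qed.

Lemma simplex_dist_le1 p q i : `|p i 0 - q i 0| <= 1.
Proof.
have := simplex_le1 p i; have := simplex_le1 q i.
have := simplex_ge0 p i; have := simplex_ge0 q i.
rewrite ler_norml; lra.
Qed.

Definition l1_dist p q : R := \sum_i `|p i 0 - q i 0|.

Lemma l1_distC p q : l1_dist p q = l1_dist q p.
Proof. by apply: eq_bigr => i _; rewrite distrC. Qed.

Lemma l1_dist_ge0 p q : 0 <= l1_dist p q.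
Proof. exact: sumr_ge0. Qed.

Lemma l1_dist_bounded p q : l1_dist p q <= K.+1%:R.
Proof.
apply: (@le_trans _ _ (\sum_(i < K.+1) 1)).
  by apply: ler_sum => i _; exact: simplex_dist_le1.
by rewrite sumr_const card_ord.
Qed.

Lemma norm_infty_ge0 (A : 'M[R]_K.+1) : 0 <= norm_infty A.
Proof.
apply: (big_ind (fun x => 0 <= x)) => // [x y x0 y0|i _].
  by rewrite le_max x0.
exact: sumr_ge0.
Qed.

Lemma row_sum_le_norm_infty (A : 'M[R]_K.+1) i :
  \sum_j `|A i j| <= norm_infty A.
Proof. exact: (le_bigmax _ (fun i => \sum_j `|A i j|)). Qed.

(* The l1 operator norm of the inverse of [M^T] is the maximum absolute row sum
   of the inverse of [M]. *)
Lemma l1_dist_complementary M p q : (M : 'M[R]_K.+1) \in unitmx ->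
  l1_dist p q <= norm_infty (invmx (M : 'M[R]_K.+1)) *
    l1_dist (complementary M p) (complementary M q).
Proof.
move=> uM; pose N := invmx (M : 'M[R]_K.+1).
pose w := (complementary M p : 'cV[R]_K.+1) - (complementary M q : 'cV[R]_K.+1).
have wE j : `|complementary M p j 0 - complementary M q j 0| = `|w j 0|.
  by rewrite !mxE.
have vE : (p : 'cV[R]_K.+1) - (q : 'cV[R]_K.+1) = N^T *m w.
  by rewrite /w /= -mulmxBr mulmxA -trmx_mul mulmxV// trmx1 mul1mx.
rewrite /l1_dist mulr_sumr; under [leRHS]eq_bigr do rewrite wE.
apply: (@le_trans _ _ (\sum_i \sum_j `|N j i| * `|w j 0|)).
  apply: ler_sum => i _.
  have -> : p i 0 - q i 0 = \sum_j N j i * w j 0.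
    have := congr1 (fun v : 'cV[R]_K.+1 => v i 0) vE; rewrite !mxE => ->.
    by apply: eq_bigr => j _; rewrite mxE.
  by apply: le_trans (ler_norm_sum _ _ _) _; under eq_bigr do rewrite normrM.
rewrite exchange_big/=; apply: ler_sum => j _.
by rewrite -mulr_suml ler_wpM2r// row_sum_le_norm_infty.
Qed.

Lemma label_dist_set1 p i : label_dist p [set i] = (p i 0)%:E.
Proof.
rewrite /label_dist (bigD1 i)//= big1 ?adde0 => [|j ji].
  by rewrite diracE mem_set// mule1.
by rewrite diracE memNset ?mule0//= => jiE; rewrite jiE eqxx in ji.
Qed.

Lemma measurable_fun_label d (T : measurableType d) (g : 'I_K.+1 -> T) :
  measurable_fun setT g.
Proof. by []. Qed.

Lemma Rintegral_label_dist p (g : 'I_K.+1 -> R) :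
  \int[label_dist p]_i g i = \sum_i g i * p i 0.
Proof.
have mset i : measurable [set i : 'I_K.+1] by [].
have ii (i : 'I_K.+1) : (label_dist p).-integrable setT (EFin \o \1_[set i]).
  by apply: integrable_indic.
rewrite /Rintegral (eq_integral (fun x : 'I_K.+1 =>
    \sum_i (g i)%:E * (\1_[set i] x)%:E)%E); last first.
  move=> x _; rewrite (bigD1 x)//= big1 ?adde0 => [|i ix].
    by rewrite indicE mem_set// mule1.
  by rewrite indicE memNset ?mule0//= => xi; rewrite xi eqxx in ix.
rewrite integral_sum//; last by move=> i; apply: integrableZl => //; exact: ii.
rewrite (eq_bigr (fun i => (g i * p i 0)%:E)) ?sumEFin// => i _.
rewrite integralZl//; last exact: ii.
rewrite integral_indic// setIT /= EFinM.
by congr (_ * _)%E; exact: label_dist_set1.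
Qed.

(** The sign of [p - q] is a test function bounded by 1 whose integrals differ by exactly the l1
    distance. *)
Lemma d_KL_label_dist_ge p q (t : R) : 0 < t ->
  ((t * l1_dist p q - 4 * t ^+ 2)%:E <= d_KL (label_dist p) (label_dist q))%E.
Proof.
move=> t0; pose g i : R := Num.sg (p i 0 - q i 0).
have g1 i : `|g i| <= 1 by rewrite /g normr_sg; case: (_ != 0); rewrite ?lexx.
have := d_KL_ge_quadratic (label_dist p) (label_dist q)
  (measurable_fun_label _) g1 t0.
rewrite !Rintegral_label_dist -sumrB.
under eq_bigr do rewrite -mulrBr /g -normrEsg.
exact.
Qed.

End simplex.

(** * Averaging over the features *)

Section conditional.
Context d (X : measurableType d) (R : realType) (K : nat).
Implicit Types (mu nu : probability X R) (p q : X -> simplex R K).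

Lemma measurable_l1_dist p q : measurable_simplex p -> measurable_simplex q ->
  measurable_fun setT (fun x => l1_dist (p x) (q x)).
Proof.
move=> mp mq; apply: measurable_sum => i; apply: measurableT_comp => //.
by apply: measurable_funB; [exact: mp|exact: mq].
Qed.

Lemma integrable_l1_dist mu p q :
  measurable_simplex p -> measurable_simplex q ->
  mu.-integrable setT (EFin \o (fun x => l1_dist (p x) (q x))).
Proof.
move=> mp mq; apply: (@probability_bounded_integrable _ _ _ _ _ K.+1%:R).
  exact: measurable_l1_dist.
by move=> x; rewrite ger0_norm ?l1_dist_ge0// l1_dist_bounded.
Qed.

Lemma measurable_complementary (M : transition_matrix R K) p :
  measurable_simplex p -> measurable_simplex (fun x => complementary M (p x)).
Proof.
move=> mp i; rewrite (_ : (fun x => _) = fun x => \sum_j M j i * p x j 0).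
  by apply: measurable_sum => j; apply: measurable_funM => //; exact: mp.
by apply/funext => x; rewrite !mxE; apply: eq_bigr => j _; rewrite mxE.
Qed.

(** The pointwise bound is integrated with the same [t] for all features and [t] is eliminated
    afterwards; 5 is [1 + c] with [c = 4]. *)
Lemma l1_dist_le_d_KL_cond mu p q :
  measurable_simplex p -> measurable_simplex q ->
  ((\int[mu]_x l1_dist (p x) (q x))%:E <= 5%:E * sqrte (d_KL_cond mu p q))%E.
Proof.
move=> mp mq; rewrite (_ : 5 = 1 + 4 :> R); last by ring.
apply: le_sqrte_of_quadratic => // t t0.
have Di := integrable_l1_dist mu mp mq.
have mD := measurable_l1_dist mp mq.
pose f x := t * l1_dist (p x) (q x) - 4 * t ^+ 2.
have mf : measurable_fun setT f.
  by apply: measurable_funB => //; exact: measurable_funM.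
have tDi : mu.-integrable setT (EFin \o (fun x => t * l1_dist (p x) (q x))).
  by have := integrableZl measurableT t Di.
have ci : mu.-integrable setT (EFin \o cst (4 * t ^+ 2)).
  exact: finite_measure_integrable_cst.
have fi : mu.-integrable setT (EFin \o f).
  by have := integrableB measurableT tDi ci.
apply: (@le_trans _ _ (\int[mu]_x (f x)%:E)%E).
  rewrite -EFin_Rintegral// lee_fin RintegralB// RintegralZl//.
  by rewrite Rintegral_cstT.
(* Truncation at 0 yields a nonnegative integrand, still below the divergence because the latter is
   nonnegative. *)
apply: (@le_trans _ _ (\int[mu]_x (Num.max (f x) 0)%:E)%E).
  apply: ae_le_integralT; [exact/measurable_EFinP| |].
    by apply/measurable_EFinP; exact: measurable_maxr.
  by apply: aeW => x; rewrite lee_fin le_max lexx.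
apply: ge0_le_integralT => x; first by rewrite lee_fin le_max lexx orbT.
have [_|_] := leP (f x) 0; first exact: d_KL_ge0.
exact: d_KL_label_dist_ge.
Qed.

(** The factor 2 compensates the halved difference in the JS bound; replacing [g] by [- g] fixes the
    sign. *)
Lemma Rintegral_le_d_JS mu nu (g : X -> R) :
  measurable_fun setT g -> (forall x, `|g x| <= 1) ->
  (`|\int[mu]_x g x - \int[nu]_x g x|%:E <= (2 * 5)%:E * sqrte (d_JS mu nu))%E.
Proof.
move=> mg g1.
wlog gmunu : g mg g1 / 0 <= \int[mu]_x g x - \int[nu]_x g x.
  move=> H; have [|/ltW munug] := leP 0 (\int[mu]_x g x - \int[nu]_x g x).
    exact: H.
  have RN (P : probability X R) : \int[P]_x (- g x) = - \int[P]_x g x.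
    by apply: RintegralN; exact: probability_bounded_integrable g1.
  have := H (fun x => - g x); rewrite !RN -opprD normrN; apply.
  - exact: measurableT_comp.
  - by move=> x; rewrite normrN.
  - by rewrite oppr_ge0.
rewrite ger0_norm// -[_ - _](divfK (_ : 2 != 0 :> R))//.
rewrite mulrC EFinM EFinM -muleA.
rewrite lee_wpmul2l// (_ : 5 = 1 + 4 :> R); last by ring.
apply: le_sqrte_of_quadratic => // t t0; exact: d_JS_ge_quadratic.
Qed.

(* The conditional probability, given the feature x, that the pair of x and a
   label distributed according to [p x] falls in [A]. *)
Definition section_prob (A : set (X * 'I_K.+1)) p (x : X) : R :=
  \sum_i \1_(ysection A i) x * p x i 0.

Lemma measurable_section_prob A p : measurable A -> measurable_simplex p ->
  measurable_fun setT (section_prob A p).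
Proof.
move=> mA mp; apply: measurable_sum => i.
apply: measurable_funM; last exact: mp.
exact/measurable_indic/measurable_ysection.
Qed.

Lemma section_prob_bounded A p x : `|section_prob A p x| <= 1.
Proof.
have s0 i : 0 <= \1_(ysection A i) x * p x i 0.
  by rewrite mulr_ge0// simplex_ge0.
rewrite ger0_norm ?sumr_ge0// -(simplex_sum1 (p x)); apply: ler_sum => i _.
by rewrite ler_piMl ?simplex_ge0// indicE; case: (_ \in _).
Qed.

Lemma integrable_section_prob mu A p : measurable A -> measurable_simplex p ->
  mu.-integrable setT (EFin \o section_prob A p).
Proof.
move=> mA mp; apply: probability_bounded_integrable (section_prob_bounded A p).
exact: measurable_section_prob.
Qed.

Lemma section_prob_dist_le mu A p q :
  measurable A -> measurable_simplex p -> measurable_simplex q ->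
  `|\int[mu]_x section_prob A p x - \int[mu]_x section_prob A q x|
    <= \int[mu]_x l1_dist (p x) (q x).
Proof.
move=> mA mp mq.
have pi := integrable_section_prob mu mA mp.
have qi := integrable_section_prob mu mA mq.
have pqi : mu.-integrable setT
    (EFin \o (fun x => section_prob A p x - section_prob A q x)).
  by have := integrableB measurableT pi qi.
rewrite -RintegralB//; apply: le_trans (le_normr_Rintegral _ pqi) _ => //.
apply: le_Rintegral => //; first by have := integrable_norm pqi.
  exact: integrable_l1_dist.
move=> x _; rewrite -sumrB; apply: le_trans (ler_norm_sum _ _ _) _.
apply: ler_sum => i _; rewrite -mulrBr normrM ler_piMl// indicE.
by case: (_ \in _); rewrite ?normr1 ?normr0.
Qed.

Lemma prod_label_bigcup (A : set (X * 'I_K.+1)) :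
  A = \big[setU/set0]_(i < K.+1) (ysection A i `*` [set i]).
Proof.
apply/seteqP; split => [[x i] Axi|].
  by rewrite (bigD1 i)//=; left; split => //=; rewrite /ysection/= inE.
apply: (big_ind (fun B => B `<=` A)) => [//|B B' BA B'A u|i _ [x j]].
  by move=> [/BA|/B'A].
by case=> /=; rewrite /ysection/= inE => + ->.
Qed.

(** With finitely many labels, [A] is a finite disjoint union of rectangles [ysection A i] times
    [[set i]], on which the conditional distribution gives [P] by definition. *)
Lemma is_conditionalE (P : probability (X * 'I_K.+1)%type R) p A :
  is_conditional P p -> measurable A ->
  P A = (\int[marginal P]_x section_prob A p x)%:E.
Proof.
move=> [mp pP] mA.
have mAi i : measurable (ysection A i) by exact: measurable_ysection.
have ei i : (marginal P).-integrable setT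
    (EFin \o (fun x => \1_(ysection A i) x * p x i 0)).
  apply: (@probability_bounded_integrable _ _ _ _ _ 1).
    by apply: measurable_funM; [exact: measurable_indic|exact: mp].
  move=> x; rewrite ger0_norm ?mulr_ge0 ?simplex_ge0//.
  by rewrite mulr_ile1 ?simplex_ge0 ?simplex_le1// indicE; case: (_ \in _).
rewrite EFin_Rintegral; last exact: integrable_section_prob.
rewrite {1}(prod_label_bigcup A) measure_bigsetU_ord//; last 2 first.
  by move=> i; apply: measurableX.
  apply/trivIsetP => i j _ _ ij; rewrite -subset0.
  by move=> [x k] [[_ /= ->] [_ /= ji]]; rewrite ji eqxx in ij.
rewrite /section_prob; under eq_integral do rewrite -sumEFin.
rewrite integral_sum//; apply: eq_bigr => i _.
apply: (eq_trans (pP _ i (mAi i))); apply: (eq_trans (integral_mkcond _ _)).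
apply: eq_integral => x _.
by rewrite patchE indicE; case: ifPn => _; rewrite ?mul1r ?mul0r.
Qed.

(** * The total variation bound *)

Lemma d_TV_le (P Q : probability (X * 'I_K.+1)%type R)
    (pYX qYX C : X -> simplex R K)
    (M : transition_matrix R K) :
  is_conditional P pYX -> is_conditional Q qYX -> measurable_simplex C ->
  (M : 'M[R]_K.+1) \in unitmx ->
  (d_TV P Q <=
    (2 * 5)%:E * sqrte (d_JS (marginal P) (marginal Q))
    + (5 * norm_infty (invmx (M : 'M[R]_K.+1)))%:E
        * sqrte (d_KL_cond (marginal P)
            (fun x => complementary M (pYX x))
            (fun x => complementary M (C x)))
    + 5%:E * sqrte (d_KL_cond (marginal Q) qYX C))%E.
Proof.
move=> cP cQ mC uM; have [mp _] := cP; have [mq _] := cQ.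
apply: ge_ereal_sup => _ [A mA <-].
rewrite (is_conditionalE cP mA) (is_conditionalE cQ mA) -EFinB abse_EFin.
set a := \int[_]_x _; set b := \int[_]_x _.
pose N := norm_infty (invmx (M : 'M[R]_K.+1)).
pose aC := \int[marginal P]_x section_prob A C x.
pose bC := \int[marginal Q]_x section_prob A C x.
(* The terms are a change of marginal with [C] fixed, then a change of conditional under each
   marginal; they match the three summands of the bound in order. *)
apply: (@le_trans _ _ (`|aC - bC|%:E + `|a - aC|%:E + `|b - bC|%:E)%E).
  rewrite -!EFinD lee_fin.
  rewrite (_ : a - b = (aC - bC) + (a - aC) - (b - bC)); last by ring.
  by apply: le_trans (ler_normB _ _) _; rewrite lerD2r ler_normD.
apply: leeD; first apply: leeD.
- apply: Rintegral_le_d_JS; first exact: measurable_section_prob.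
  exact: section_prob_bounded.
- have mMp := measurable_complementary M mp.
  have mMC := measurable_complementary M mC.
  rewrite mulrC EFinM -muleA; apply: le_trans (lee_wpmul2l _
    (l1_dist_le_d_KL_cond (marginal P) mMp mMC)); last first.
    by rewrite lee_fin norm_infty_ge0.
  rewrite -EFinM lee_fin; apply: le_trans (section_prob_dist_le _ mA mp mC) _.
  rewrite -RintegralZl//; last exact: integrable_l1_dist.
  apply: le_Rintegral => //; first exact: integrable_l1_dist.
    have Di := integrable_l1_dist (marginal P) mMp mMC.
    by have := integrableZl measurableT N Di.
  by move=> x _; exact: l1_dist_complementary.
- apply: le_trans (l1_dist_le_d_KL_cond _ mq mC); rewrite lee_fin.
  exact: section_prob_dist_le.
Qed.

End conditional.

Theorem theorem1 (R : realType) :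
  exists c1 c2 : R, [/\ 0 < c1, 0 < c2 &
    forall (d K : nat)
      (P Q : probability (d.-tuple (measurableTypeR R) * 'I_K.+1)%type R)
      (pYX qYX C : d.-tuple (measurableTypeR R) -> simplex R K)
      (M : transition_matrix R K),
      is_conditional P pYX ->
      is_conditional Q qYX ->
      measurable_simplex C ->
      \rank (M : 'M[R]_K.+1) = K.+1 ->
      (d_TV P Q <=
        (2 * c1)%:E * sqrte (d_JS (marginal P) (marginal Q))
        + (c2 * norm_infty (invmx (M : 'M[R]_K.+1)))%:E
            * sqrte (d_KL_cond (marginal P)
                (fun x => complementary M (pYX x))
                (fun x => complementary M (C x)))
        + c2%:E * sqrte (d_KL_cond (marginal Q) qYX C))%E].
Proof.
(* Both constants are the [1 + 4] coming from the quadratic term [4 * t ^+ 2]; full rank enters as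
   invertibility of [M]. *)
exists 5, 5; split => // d K P Q pYX qYX C M cP cQ mC /eqP rM.
by apply: d_TV_le => //; rewrite -row_free_unit.
Qed.
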